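(* For $k\ge 0$ let $V^k=\ell_2(\mathbb{Z})$ and let $\mathcal{F}=L_2(\mathbb{R})$ with norm $\|\cdot\|$. Let $\{P_k^{k+1}\}_{k\ge 0}$, $P_k^{k+1}:V^k\to V^{k+1}$, be a convergent sequence of linear prediction operators in $\mathcal{F}$, and let $\{\mathcal{R}_k^H\}_{k\ge0}$ be an associated sequence of injective linear reconstruction operators $\mathcal{R}_k^H:V^k\to\mathcal{F}$ satisfying $$\mathcal{R}_{k+1}^H P_k^{k+1}=\mathcal{R}_k^H\qquad\text{for all }k\ge 0 .$$ Denote $\|v\|_{k,H}:=\|\mathcal{R}_k^H v\|$ for $v\in V^k$. Then the operators $\mathcal{D}_k:\mathcal{F}\to V^k$ and $D_{k+1}^k:V^{k+1}\to V^k$ given, for $k\ge0$, by $$\mathcal{D}_k f:=\operatorname{argmin}_{v\in V^k}\|f-\mathcal{R}_k^H v\|^2,\qquad D_{k+1}^k w:=\operatorname{argmin}_{v\in V^k}\|w-P_k^{k+1}v\|_{k+1,H}^2$$ are discretization and decimation operators consistent with $\mathcal{R}_k^H$ and $P_k^{k+1}$, respectively (that is, $\mathcal{D}_k\mathcal{R}_k^H=I_{V^k}$ and $D_{k+1}^kP_k^{k+1}=I_{V^k}$). Furthermore, the sequence of discretization operators $\{\mathcal{D}_k\}_{k\ge0}$ is nested and, for all $k\ge 0$, $$D_{k+1}^k=\mathcal{D}_k\mathcal{R}_{k+1}^H,\qquad P_k^{k+1}=\mathcal{D}_{k+1}\mathcal{R}_k^H .$$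
   Context: Here $\ell_2(\mathbb{Z})$ and $L_2(\mathbb{R})$ are the Hilbert spaces of real square-summable sequences and real square-integrable functions with their standard inner products. The notation $\operatorname{argmin}$ denotes the (unique) minimizer. Convergent sequence of prediction operators: a sequence of injective operators $P_k^{k+1}:V^k\to V^{k+1}$, $k\ge 0$, is called a convergent sequence of prediction operators in $\mathcal{F}$ if there exists a sequence of injective operators $\mathcal{R}_k:V^k\to\mathcal{F}$ with $\mathcal{R}_k(V^k)\subset\mathcal{R}_{k+1}(V^{k+1})$ such that for all $k\ge0$ and all $v^k\in V^k$ the limit $\lim_{L\to\infty}\mathcal{R}_L P_{L-1}^L P_{L-2}^{L-1}\cdots P_k^{k+1}v^k$ exists. Discretization operator: a linear operator $\mathcal{D}:\mathcal{F}\to V$ with $V=\mathcal{D}(\mathcal{F})$, where $V$ has a denumerable basis (for $\ell_2(\mathbb{Z})$, its standard Hilbert basis). Nested: a sequence $\{\mathcal{D}_k\}_{k\ge0}$ of discretization operators $\mathcal{D}_k:\mathcal{F}\to V^k$ is nested if for all $f\in\mathcal{F}$ and $k\ge0$, $\mathcal{D}_{k+1}f=0$ implies $\mathcal{D}_kf=0$. Decimation operators: for a nested sequence $\{\mathcal{D}_k\}$, the decimation operator $D_{k+1}^k:V^{k+1}\to V^k$ is the map $\mathcal{D}_{k+1}f\mapsto\mathcal{D}_kf$, $f\in\mathcal{F}$. Reconstruction operator: an operator $\mathcal{R}:V\to\mathcal{F}$ is a reconstruction operator compatible (consistent) with a discretization operator $\mathcal{D}:\mathcal{F}\to V$ if $\mathcal{D}\mathcal{R}=I_V$;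 in particular it is injective. Likewise, consistency of a prediction operator $P_k^{k+1}$ with a decimation operator $D_{k+1}^k$ means $D_{k+1}^kP_k^{k+1}=I_{V^k}$. Here $I_V$ is the identity of $V$.
   Formalization: The formal theorem additionally assumes that the minimizer defining D_k f exists for every k and every f in L_2(R); without it (e.g. if the range of R_k^H is dense but not closed) the operators D_k are undefined. *)

(* Defs.v *)
From HB Require Import structures.
From mathcomp Require Import all_boot all_order all_algebra.
From mathcomp Require Import all_classical all_reals all_analysis.
From mathcomp Require Import measurable_realfun ess_sup_inf.

Set Implicit Arguments.
Unset Strict Implicit.
Unset Printing Implicit Defensive.
Import Order.TTheory GRing.Theory Num.Theory.
Import numFieldNormedType.Exports.
Local Open Scope classical_set_scope.
Local Open Scope ring_scope.

Section Lspace_structure.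
Context d (T : measurableType d) (R : realType).
Variables (mu : {measure set T -> \bar R}) (p : \bar R) (p1 : (1 <= p)%E).

Local Notation L := (LspaceType mu p1).
Local Notation LF := (LfunType mu p1).
Local Notation pi_mu := (\pi_({mfun_ mu, T >-> measurableTypeR R}))%qT.
Local Open Scope quotient_scope.

HB.instance Definition _ := gen_eqMixin L.
HB.instance Definition _ := gen_choiceMixin L.

Lemma Lspace_Lfun (f : L) : (f : T -> R) \in Lfun mu p.
Proof.
rewrite inE; apply/andP; split; rewrite inE /=.
  exact: (@measurable_funPT _ _ _ _ (repr (LebesgueSpace.sort f))).
exact: Lebesgue_finite.
Qed.

Definition Lrepr (f : L) : LF := Lfun_Sub p1 (Lspace_Lfun f).

Lemma pi_ae (h : {mfun T >-> measurableTypeR R}) :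
  (repr (pi_mu h) : T -> R) = h %[ae mu].
Proof.
have : repr (pi_mu h) = h %[mod {mfun_ mu, T >-> measurableTypeR R}].
  by rewrite reprK.
by move=> /eqmodP; rewrite /= /ae_eq_op => /asboolP.
Qed.

Lemma Lnorm_ae (f g : T -> R) :
  measurable_fun setT f -> measurable_fun setT g -> f = g %[ae mu] ->
  'N[mu]_p[EFin \o f]%E = 'N[mu]_p[EFin \o g]%E.
Proof.
have mpow (h : T -> R) (r : R) : measurable_fun setT h ->
    measurable_fun setT (fun x => `|(EFin \o h) x| `^ r)%E.
  move=> mh; apply: (@measurableT_comp _ _ _ _ _ _ (fun x => x `^ r)%E) => //=.
    exact: (measurableT_comp (measurable_poweR _)).
  by do 2 apply: measurableT_comp => //.
move=> mf mg fg; rewrite unlock /Lnorm; case: p p1 => [r _| _ |//].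
- congr (_ `^ _)%E; apply: ge0_ae_eq_integral => //; try exact: mpow.
  + by move=> x _; rewrite poweR_ge0.
  + by move=> x _; rewrite poweR_ge0.
  + by apply: filterS fg => x + _ => /(_ I) /= ->.
- case: ifP => // _; apply: eq_ess_sup.
  by apply: filterS fg => x /(_ I) /= ->.
Qed.

Definition Lfun_mfun (h : LF) : {mfun T >-> measurableTypeR R} :=
  HB.pack (h : T -> measurableTypeR R) (@isMeasurableFun.Build _ _ T
    (measurableTypeR R) h (@measurable_funPT _ _ _ _ h)).

Definition Lclass_mfun (h : LF) : {mfun_ mu, T >-> measurableTypeR R} :=
  pi_mu (Lfun_mfun h).

Lemma Lclass_finite_norm (h : LF) : finite_norm mu p (Lclass_mfun h).
Proof.
have /= := @Lnorm_ae (repr (Lclass_mfun h) : T -> R) h.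
rewrite /finite_norm => -> //; first exact: Lfunction_finite.
- exact: (@measurable_funPT _ _ _ _ (repr (Lclass_mfun h))).
- exact: (pi_ae (Lfun_mfun h)).
Qed.

(* the class of h modulo almost-everywhere equality *)
Definition Lclass (h : LF) : L := HB.pack (Lclass_mfun h)
  (@isFinLebesgue.Build _ _ _ mu p p1 _ (Lclass_finite_norm h)).

Lemma LclassE (h : LF) : (Lclass h : T -> R) = h %[ae mu].
Proof. exact: (pi_ae (Lfun_mfun h)). Qed.

Lemma Lspace_eq (f g : L) : (f : T -> R) = g %[ae mu] -> f = g.
Proof.
move=> fg; have : LebesgueSpace.sort f = LebesgueSpace.sort g.
  rewrite -[LHS]reprK -[RHS]reprK; apply/eqmodP; apply/asboolP.
  exact: fg.
case: f g {fg} => [f [[hf]]] [g [[hg]]] /= fg.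
by case: _ / fg hg => hg; rewrite (Prop_irrelevance hf hg).
Qed.

Definition Lspace_zero : L := Lclass 0.
Definition Lspace_opp (f : L) : L := Lclass (- Lrepr f).
Definition Lspace_add (f g : L) : L := Lclass (Lrepr f + Lrepr g).
Definition Lspace_scale (a : R) (f : L) : L := Lclass (a *: Lrepr f).
Definition Lspace_norm (f : L) : R := fine ('N[mu]_p[EFin \o f]%E).

Lemma Lspace_zeroE : (Lspace_zero : T -> R) = cst 0 %[ae mu].
Proof. exact: LclassE. Qed.

Lemma Lspace_oppE (f : L) : (Lspace_opp f : T -> R) = \- f %[ae mu].
Proof. exact: LclassE. Qed.

Lemma Lspace_addE (f g : L) : (Lspace_add f g : T -> R) = f \+ g %[ae mu].
Proof. exact: LclassE. Qed.

Lemma Lspace_scaleE (a : R) (f : L) :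
  (Lspace_scale a f : T -> R) = (fun x => a * f x) %[ae mu].
Proof. exact: LclassE. Qed.

Let ae_and (P Q : T -> Prop) :
  {ae mu, forall x, P x} -> {ae mu, forall x, Q x} ->
  {ae mu, forall x, P x /\ Q x}.
Proof. by apply: filterS2 => x ? ?; split. Qed.

Lemma Lspace_addA : associative Lspace_add.
Proof.
move=> f g h; apply: Lspace_eq.
have := ae_and
  (ae_and (Lspace_addE f (Lspace_add g h)) (Lspace_addE g h))
  (ae_and (Lspace_addE (Lspace_add f g) h) (Lspace_addE f g)).
apply: filterS => x [] [] /(_ I) e1 /(_ I) e2 [] /(_ I) e3 /(_ I) e4 _.
by rewrite e1 e3 /= e2 e4 /= addrA.
Qed.

Lemma Lspace_addC : commutative Lspace_add.
Proof.
move=> f g; apply: Lspace_eq.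
have := ae_and (Lspace_addE f g) (Lspace_addE g f).
by apply: filterS => x [] /(_ I) e1 /(_ I) e2 _; rewrite e1 e2 /= addrC.
Qed.

Lemma Lspace_add0 : left_id Lspace_zero Lspace_add.
Proof.
move=> f; apply: Lspace_eq.
have := ae_and (Lspace_addE Lspace_zero f) Lspace_zeroE.
by apply: filterS => x [] /(_ I) e1 /(_ I) e2 _; rewrite e1 /= e2 add0r.
Qed.

Lemma Lspace_addN : left_inverse Lspace_zero Lspace_opp Lspace_add.
Proof.
move=> f; apply: Lspace_eq.
have := ae_and (Lspace_addE (Lspace_opp f) f)
  (ae_and Lspace_zeroE (Lspace_oppE f)).
apply: filterS => x [] /(_ I) e1 [] /(_ I) e2 /(_ I) e3 _.
by rewrite e1 e2 /= e3 addNr.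
Qed.

HB.instance Definition _ := GRing.isZmodule.Build L
  Lspace_addA Lspace_addC Lspace_add0 Lspace_addN.

Lemma Lspace_scaleA a b (f : L) :
  Lspace_scale a (Lspace_scale b f) = Lspace_scale (a * b) f.
Proof.
apply: Lspace_eq.
have := ae_and (Lspace_scaleE a (Lspace_scale b f))
  (ae_and (Lspace_scaleE b f) (Lspace_scaleE (a * b) f)).
apply: filterS => x [] /(_ I) e1 [] /(_ I) e2 /(_ I) e3 _.
by rewrite e1 e3 e2 mulrA.
Qed.

Lemma Lspace_scale1 : left_id 1 Lspace_scale.
Proof.
move=> f; apply: Lspace_eq; have := Lspace_scaleE 1 f.
by apply: filterS => x /(_ I) e1 _; rewrite e1 mul1r.
Qed.

Lemma Lspace_scaleDr : right_distributive Lspace_scale +%R.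
Proof.
move=> a f g; apply: Lspace_eq.
have := ae_and
  (ae_and (Lspace_scaleE a (Lspace_add f g)) (Lspace_addE f g))
  (ae_and (Lspace_addE (Lspace_scale a f) (Lspace_scale a g))
    (ae_and (Lspace_scaleE a f) (Lspace_scaleE a g))).
apply: filterS => x [] [] /(_ I) e1 /(_ I) e2 [] /(_ I) e3 [] /(_ I) e4 /(_ I) e5 _.
by rewrite e1 e3 /= e2 e4 e5 /= mulrDr.
Qed.

Lemma Lspace_scaleDl (f : L) : {morph Lspace_scale^~ f : a b / a + b}.
Proof.
move=> a b; apply: Lspace_eq.
have := ae_and (Lspace_scaleE (a + b) f)
  (ae_and (Lspace_addE (Lspace_scale a f) (Lspace_scale b f))
    (ae_and (Lspace_scaleE a f) (Lspace_scaleE b f))).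
apply: filterS => x [] /(_ I) e1 [] /(_ I) e3 [] /(_ I) e4 /(_ I) e5 _.
by rewrite e1 e3 /= e4 e5 mulrDl.
Qed.

HB.instance Definition _ := GRing.Zmodule_isLmodule.Build R L
  Lspace_scaleA Lspace_scale1 Lspace_scaleDr Lspace_scaleDl.

Let norm_Lclass (h : LF) : Lspace_norm (Lclass h) = fine 'N[mu]_p[EFin \o h]%E.
Proof.
congr fine; apply: Lnorm_ae => //; last exact: LclassE.
exact: (@measurable_funPT _ _ _ _ (Lrepr (Lclass h))).
Qed.

Lemma Lspace_normD (f g : L) :
  Lspace_norm (f + g) <= Lspace_norm f + Lspace_norm g.
Proof. by rewrite norm_Lclass; exact: (ler_LnormD (Lrepr f) (Lrepr g)). Qed.

Lemma Lspace_normZ (a : R) (f : L) :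
  Lspace_norm (a *: f) = `|a| * Lspace_norm f.
Proof.
rewrite norm_Lclass; apply: EFin_inj; rewrite finite_norm_fine EFinM.
by rewrite (finite_norm_fine (Lrepr f)) -LnormZ.
Qed.

Lemma Lspace_norm_eq0 (f : L) : Lspace_norm f = 0 -> f = 0.
Proof.
move=> /(fine_Lnormr_eq0 (f := Lrepr f)) f0; apply: Lspace_eq.
have := ae_and f0 Lspace_zeroE.
by apply: filterS => x [] /(_ I) e1 /(_ I) e2 _; exact: etrans e1 (esym e2).
Qed.

HB.instance Definition _ := @Lmodule_isNormed.Build R L
  Lspace_norm Lspace_normD Lspace_normZ Lspace_norm_eq0.

End Lspace_structure.

HB.instance Definition _ := isPointed.Build int 0.

HB.instance Definition _ := @isMeasurable.Build default_measure_display
  int discrete_measurable discrete_measurable0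
  discrete_measurableC discrete_measurableU.

(* Equality in the Lspace types is Leibniz equality of classes modulo
   almost-everywhere equality. For the counting measure on the discrete space
   int, the only null set is the empty one and every sequence is measurable, so
   ell2 R is the space of real square-summable sequences indexed by Z. *)
Definition ell2 (R : realType) := LspaceType (@counting int R) (lee1n 2).
HB.instance Definition _ R := NormedModule.on (ell2 R).

Definition L2 (R : realType) := LspaceType (@lebesgue_measure R) (lee1n 2).
HB.instance Definition _ R := NormedModule.on (L2 R).

Definition ell2_dot (R : realType) (u v : ell2 R) : R :=
  \int[@counting int R]_n (u n * v n).

Definition hilbert_basis (R : realType) (e : nat -> ell2 R) : Prop :=
  (forall i j, ell2_dot (e i) (e j) = (i == j)%:R) /\
  (forall v : ell2 R,
    (fun n => \sum_(i < n) ell2_dot v (e i) *: e i) @ \oo --> v).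

Section multiresolution.
Context (R : realType).
Local Notation V := (ell2 R).
Local Notation F := (L2 R).

Definition discretization (D : F -> V) : Prop :=
  [/\ linear D, range D = setT & exists e : nat -> V, hilbert_basis e].

Definition nested (D : nat -> F -> V) : Prop :=
  forall f k, D k.+1 f = 0 -> D k f = 0.

(* Since D k.+1 is onto, this equation determines Dec; that Dec exists is the
   nestedness of D. *)
Definition decimation (D : nat -> F -> V) (k : nat) (Dec : V -> V) : Prop :=
  forall f, Dec (D k.+1 f) = D k f.

Definition consistent (A B : Type) (coarsen : B -> A) (refine : A -> B) : Prop :=
  coarsen \o refine = id.

(* P (k + n - 1) \o ... \o P k, from level k to level k + n *)
Fixpoint cascade (P : nat -> V -> V) (k n : nat) (v : V) : V :=
  if n is m.+1 then P (k + m)%N (cascade P k m v) else v.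

Definition convergent_prediction (P : nat -> V -> V) : Prop :=
  (forall k, injective (P k)) /\
  exists Rec : nat -> V -> F,
    [/\ forall k, injective (Rec k),
        forall k, range (Rec k) `<=` range (Rec k.+1) &
        forall k v, cvgn (fun n => Rec (k + n)%N (cascade P k n v))].

Definition minimizer (J : V -> R) (v : V) : Prop := forall w, J v <= J w.

(* a minimizer of J, with junk value 0 if J has none *)
Definition argmin (J : V -> R) : V := xget 0 [set v | minimizer J v].

Definition hnorm (RH : nat -> V -> F) (k : nat) (v : V) : R := `|RH k v|.

Definition discr_cost (RH : nat -> V -> F) (k : nat) (f : F) (v : V) : R :=
  `|f - RH k v| ^+ 2.

Definition decim_cost (P : nat -> V -> V) (RH : nat -> V -> F) (k : nat)
    (w v : V) : R :=
  hnorm RH k.+1 (w - P k v) ^+ 2.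

Definition discr_op (RH : nat -> V -> F) (k : nat) (f : F) : V :=
  argmin (discr_cost RH k f).

Definition decim_op (P : nat -> V -> V) (RH : nat -> V -> F) (k : nat)
    (w : V) : V :=
  argmin (decim_cost P RH k w).

End multiresolution.

(* Main.v *)
(* Write R_k for [RH k]. By the usual variational argument, v minimizes
   |f - R_k v|^2 exactly when f - R_k v is orthogonal to the range of R_k; hence
   the minimizer is unique (R_k being injective) and D_k is linear. Moreover
   R_k (D_k f) is the orthogonal projection of f onto that range. Since
   R_(k+1) P_k = R_k, the ranges increase and the cost of the decimation problem
   for w is the cost of the discretization problem for R_(k+1) w, so that
   Dec_k = D_k R_(k+1). All the other claims express that projecting onto the
   range of R_(k+1) and then onto that of R_k is projecting onto the latter. *)

Require Import Defs.
From HB Require Import structures.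
From mathcomp Require Import all_boot all_order all_algebra.
From mathcomp Require Import all_classical all_reals all_analysis.
From mathcomp Require Import ring lra.
Import Order.TTheory GRing.Theory Num.Theory.
Import numFieldNormedType.Exports.
Local Open Scope classical_set_scope.
Local Open Scope ring_scope.

(** * The inner product of square-integrable classes over an arbitrary measure *)

Section Lspace2_dot.
Context {d} {T : measurableType d} {R : realType}.
Context {mu : {measure set T -> \bar R}}.
Local Notation L2mu := (LspaceType mu (lee1n 2)).
Implicit Types f g h : L2mu.

(** At the counting measure this unfolds to [ell2_dot], so one set of lemmas serves both [ell2] and
    [L2]. *)
Definition Ldot f g : R := \int[mu]_x (f x * g x).

Lemma integrable_Lspace_mul f g :
  mu.-integrable setT (EFin \o (fun x => f x * g x)).
Proof.
exact/Lfun1_integrable/(Lfun2_mul_Lfun1 (Lspace_Lfun f) (Lspace_Lfun g)).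
Qed.

Lemma LdotC f g : Ldot f g = Ldot g f.
Proof. by apply: eq_Rintegral => x _; rewrite mulrC. Qed.

(** The representative of the class [f + g] is the pointwise sum only almost everywhere, hence the
    use of [ae_eq_integral]. *)
Lemma LdotDl f g h : Ldot (f + g) h = Ldot f h + Ldot g h.
Proof.
rewrite /Ldot -RintegralD//; try exact: integrable_Lspace_mul.
congr fine; apply: ae_eq_integral => //.
- exact: measurable_int (integrable_Lspace_mul _ _).
- apply: measurable_int (integrableD _ (integrable_Lspace_mul f h)
    (integrable_Lspace_mul g h)) => //.
- by apply: filterS (Lspace_addE f g) => x /(_ I)/= e _; rewrite e mulrDl.
Qed.

Lemma LdotZl a f h : Ldot (a *: f) h = a * Ldot f h.
Proof.
rewrite /Ldot -RintegralZl//; last exact: integrable_Lspace_mul.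
congr fine; apply: ae_eq_integral => //.
- exact: measurable_int (integrable_Lspace_mul _ _).
- apply: measurable_int (integrableZl _ a (integrable_Lspace_mul f h)) => //.
- by apply: filterS (Lspace_scaleE a f) => x /(_ I)/= e _; rewrite e mulrA.
Qed.

Lemma Lnorm_sqrE f : ((`|f| ^+ 2)%:E = \int[mu]_x ((f x) ^+ 2)%:E)%E.
Proof.
have -> : `|f| = fine ('N[mu]_2%:E[EFin \o Lrepr f])%E by [].
rewrite -powR_mulrn ?fine_ge0 ?Lnorm_ge0// -poweR_EFin finite_norm_fine.
rewrite powR_Lnorm ?pnatr_eq0//; apply: eq_integral => x _ /=.
by rewrite powR_mulrn// -normrX ger0_norm ?sqr_ge0.
Qed.

Lemma Ldotxx f : Ldot f f = `|f| ^+ 2.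
Proof. by rewrite -[RHS]/(fine (_%:E)) Lnorm_sqrE; apply: eq_Rintegral. Qed.

Lemma LdotDr f g h : Ldot h (f + g) = Ldot h f + Ldot h g.
Proof. by rewrite ![Ldot h _]LdotC LdotDl. Qed.

Lemma LdotZr a f h : Ldot h (a *: f) = a * Ldot h f.
Proof. by rewrite ![Ldot h _]LdotC LdotZl. Qed.

Lemma Ldot0l f : Ldot 0 f = 0.
Proof. by rewrite -(scale0r f) LdotZl mul0r. Qed.

Lemma LdotBl f g h : Ldot (f - g) h = Ldot f h - Ldot g h.
Proof. by rewrite -scaleN1r LdotDl LdotZl mulN1r. Qed.

Lemma Ldot_suml n (F : 'I_n -> L2mu) h :
  Ldot (\sum_i F i) h = \sum_i Ldot (F i) h.
Proof.
by elim/big_ind2 : _ => [|a b c e <- <-|//]; [exact: Ldot0l|exact: LdotDl].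
Qed.

Lemma LnormD_sqr f g : `|f + g| ^+ 2 = `|f| ^+ 2 + 2 * Ldot f g + `|g| ^+ 2.
Proof. by rewrite -!Ldotxx LdotDl !LdotDr (LdotC g f); ring. Qed.

(** * Best approximation from the range of a linear map *)

Section best_approximation.
Variables (A : {linear ell2 R -> L2mu}) (f : L2mu).
Implicit Types u v : ell2 R.

Lemma minimizerP v : minimizer (fun u => `|f - A u| ^+ 2) v <->
  forall u, Ldot (f - A v) (A u) = 0.
Proof.
split=> [vmin u|v_ortho u].
- set c := Ldot _ _; pose N := `|A u| ^+ 2.
  have N0 : 0 <= N by exact: exprn_ge0.
  (* minimizes [t |-> 2 t c + t ^ 2 N] up to the shift by 1, which covers N = 0 *)
  pose t := - c / (N + 1).
  have tN : t * (N + 1) = - c by rewrite divfK// gt_eqF// ltr_wpDl.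
  have := vmin (v - t *: u).
  have -> : f - A (v - t *: u) = (f - A v) + t *: A u.
    by rewrite linearB linearZ/= opprB addrCA addrC.
  have -> := LnormD_sqr (f - A v) (t *: A u).
  have -> : Ldot (f - A v) (t *: A u) = t * c by exact: LdotZr.
  rewrite normrZ exprMn real_normK ?num_real// -/c -/N => le_t.
  have cE : c = - (t * (N + 1)) by rewrite tN opprK.
  (* Since c = - t (N + 1), minimality 0 <= 2 t c + t ^ 2 N reads t ^ 2 (N + 2) <= 0. *)
  have /eqP : t ^+ 2 = 0.
    by apply/eqP; rewrite eq_le sqr_ge0 andbT; move: le_t; rewrite cE; nra.
  by rewrite sqrf_eq0 => /eqP t0; rewrite cE t0 mul0r oppr0.
(* Pythagoras: the residual at v is orthogonal to [A (v - u)]. *)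
- have -> : f - A u = (f - A v) + A (v - u) by rewrite linearB/= addrA subrK.
  have -> := LnormD_sqr (f - A v) (A (v - u)).
  by rewrite v_ortho mulr0 addr0 lerDl exprn_ge0.
Qed.

(** [A u - A v] is a difference of two residuals, hence orthogonal to the range of [A], in which it
    also lies. *)
Lemma minimizer_uniq u v : injective A ->
  minimizer (fun w => `|f - A w| ^+ 2) u ->
  minimizer (fun w => `|f - A w| ^+ 2) v -> u = v.
Proof.
move=> A_inj /minimizerP u_ortho /minimizerP v_ortho; apply/A_inj.
apply/eqP; rewrite -subr_eq0 -normr_eq0 -sqrf_eq0 -Ldotxx.
have Auv : A u - A v = (f - A v) - (f - A u).
  by rewrite opprB [RHS]addrC subrKA.
have dotA w : Ldot (A u - A v) (A w) = 0.
  by rewrite Auv LdotBl u_ortho v_ortho subrr.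
have -> : Ldot (A u - A v) (A u - A v) = Ldot (A u - A v) (A (u - v)).
  by congr Ldot; rewrite linearB.
by apply/eqP; exact: dotA.
Qed.

End best_approximation.

End Lspace2_dot.

(** * The standard Hilbert basis of [ell2] *)

Section ell2_basis.
Context {R : realType}.
Local Notation count := (@counting int R).

(** A set of counting measure zero is finite of cardinality 0. This turns equality of classes into
    equality of sequences. *)
Lemma ae_counting (P : int -> Prop) : {ae count, forall z, P z} -> forall z, P z.
Proof.
move=> [N [_ N0 PN]] z; apply: contrapT => nPz; have := PN z nPz.
suff -> : N = set0 by [].
move: N0; rewrite /counting; case: asboolP => // finN [] /eqP.
by rewrite pnatr_eq0 finmap.cardfs_eq0 => /eqP/(fset_set_set0 finN).
Qed.

Lemma counting_set1 (z : int) :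
  (count : {measure set int -> \bar R}) [set z] = 1%E.
Proof.
by rewrite /= /counting asboolT ?fset_set1 ?finmap.cardfs1//; exact: finite_set1.
Qed.

Lemma measurable_int_fun (f : int -> R) : measurable_fun setT f.
Proof. by move=> _ Y _. Qed.

Lemma indic1_Lfun (z : int) : (\1_[set z] : int -> R) \in Lfun count 2%:E.
Proof.
rewrite inE; apply/andP; split; rewrite inE/=; first exact: measurable_int_fun.
rewrite /finite_norm (@lty_poweRy _ _ 2)// ?pnatr_eq0// powR_Lnorm ?pnatr_eq0//.
under eq_integral => x _.
  have -> : ((`|(EFin \o \1_[set z]) x|)%E `^ 2 = (\1_[set z] x)%:E :> \bar R)%E.
    by rewrite /= indicE; case: (_ \in _); rewrite /= ?normr1 ?normr0 ?powR1 ?powR0.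
  over.
by rewrite integral_indic// setIT counting_set1 ltry.
Qed.

Definition ell2_delta (z : int) : ell2 R :=
  Lclass (Lfun_Sub (lee1n 2) (indic1_Lfun z)).

Lemma ell2_deltaE z : (ell2_delta z : int -> R) = \1_[set z].
Proof.
apply/funext; apply: (@ae_counting (fun x => ell2_delta z x = \1_[set z] x)).
have := LclassE (Lfun_Sub (lee1n 2) (indic1_Lfun z)).
by apply: filterS => x /(_ I).
Qed.

Lemma ell2_dot_delta (v : ell2 R) z : ell2_dot v (ell2_delta z) = v z.
Proof.
transitivity (\int[count]_(x in [set z]) v x).
  rewrite Rintegral_mkcond; apply: eq_Rintegral => x _.
  by rewrite ell2_deltaE patch_indic.
transitivity (\int[count]_(_ in [set z]) v z).
  by apply: eq_Rintegral => x /set_mem ->.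
by rewrite Rintegral_cst// counting_set1 mulr1.
Qed.

(** Lists the integers as 0, -1, 1, -2, 2, ..., because [hilbert_basis] indexes its vectors by
    [nat]. *)
Definition int_enum (n : nat) : int := if odd n then Negz n./2 else Posz n./2.

Lemma int_enum_inj : injective int_enum.
Proof.
move=> m n; rewrite /int_enum; case: ifP => on; case: ifP => om // [] mn;
  by rewrite -(odd_double_half m) -(odd_double_half n) on om mn.
Qed.

Lemma int_enum_surj z : exists n, int_enum n = z.
Proof.
by case: z => n; [exists n.*2|exists n.*2.+1];
  rewrite /int_enum/= odd_double ?doubleK// uphalf_double.
Qed.

(** Countable additivity of the integral over the partition of the integers into singletons.
    Completeness of the basis is not presupposed, so it can be derived from this. *)
Lemma ell2_parseval (v : ell2 R) :
  (`|v| ^+ 2)%:E = (\sum_(k <oo) ((v (int_enum k)) ^+ 2)%:E)%E.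
Proof.
rewrite (Lnorm_sqrE v).
have -> : [set: int] = \bigcup_k [set int_enum k].
  by apply/seteqP; split => // z _; have [n <-] := int_enum_surj z; exists n.
rewrite ge0_integral_bigcup//.
- apply: eq_eseriesr => k _.
  transitivity (\int[count]_(_ in [set int_enum k]) ((v (int_enum k)) ^+ 2)%:E)%E.
    by apply: eq_integral => x /set_mem ->.
  by rewrite integral_cst// counting_set1 mule1.
- by move=> z _; rewrite lee_fin sqr_ge0.
- apply/trivIsetP => i j _ _ /eqP ij.
  by apply/seteqP; split => // z [-> /int_enum_inj].
Qed.

Lemma ell2_hilbert_basis : hilbert_basis (fun n => ell2_delta (int_enum n)).
Proof.
have ortho i j :
    ell2_dot (ell2_delta (int_enum i)) (ell2_delta (int_enum j)) = (i == j)%:R.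
  by rewrite ell2_dot_delta ell2_deltaE indicE in_set1 (inj_eq int_enum_inj) eq_sym.
split=> // v.
set S := fun n => _.
(* The inner products of S n with v and with itself both equal the partial sum of squares, which by
   Parseval tends to the squared norm of v. *)
have residual n : `|v - S n| ^+ 2 =
    `|v| ^+ 2 - \sum_(0 <= i < n) (v (int_enum i)) ^+ 2.
  have dotS (u : ell2 R) : Ldot (S n) u = \sum_(i < n)
      v (int_enum i) * Ldot (ell2_delta (int_enum i)) u.
    rewrite Ldot_suml; apply: eq_bigr => i _.
    by rewrite LdotZl; congr (_ * _); exact: ell2_dot_delta.
  have dotSv : Ldot (S n) v = \sum_(i < n) v (int_enum i) ^+ 2.
    rewrite dotS; apply: eq_bigr => i _.
    by rewrite LdotC [Ldot _ _]ell2_dot_delta expr2.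
  have dotSS : Ldot (S n) (S n) = \sum_(i < n) v (int_enum i) ^+ 2.
    rewrite dotS; apply: eq_bigr => i _.
    rewrite LdotC dotS (bigD1 i)//= [X in _ * (_ * X + _)]ortho eqxx mulr1.
    rewrite big1 ?addr0// => j ji; rewrite [X in _ * X]ortho.
    by rewrite (_ : (j == i :> nat) = false) ?mulr0//; exact/negbTE.
  rewrite big_mkord -!Ldotxx LdotBl ![Ldot _ (v - S n)]LdotC !LdotBl.
  by rewrite (LdotC v (S n)) dotSv dotSS subrr subr0.
have sum_cvg : (fun n => \sum_(0 <= i < n) (v (int_enum i)) ^+ 2) @ \oo -->
    `|v| ^+ 2.
  have sqr0 n : (0 <= n)%N -> (0 <= (v (int_enum n) ^+ 2)%:E)%E.
    by rewrite lee_fin sqr_ge0.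
  (* The series converges in the extended reals; its sum is finite by Parseval, so the real partial
     sums converge too. *)
  have := @is_cvg_ereal_nneg_natsum R _ 0 sqr0.
  rewrite -ell2_parseval => /fine_cvg; apply: cvg_trans; apply: near_eq_cvg.
  by apply: nearW => n /=; rewrite sumEFin.
apply/cvgrPdist_lt => e e0.
have /cvgrPdist_lt/(_ _ (exprn_gt0 2 e0)) := sum_cvg.
apply: filterS => n; rewrite -residual ger0_norm ?exprn_ge0//.
by rewrite ltr_pXn2r ?nnegrE// ltW.
Qed.

End ell2_basis.

(** * Discretization and decimation by least squares *)

Lemma argmin_minimizer {R : realType} (J : ell2 R -> R) :
  (exists v, minimizer J v) -> minimizer J (argmin J).
Proof. by case=> v Jv; rewrite /argmin; case: xgetP => [w _|/(_ v)]. Qed.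

(** The ranges of the [RH k] are not assumed closed, so the existence of best approximations,
    implicit in the argmin defining D_k, is the hypothesis [argmin_exists]. For the decimation
    problem existence follows through [costE]. *)
Theorem theorem12 (R : realType)
    (P : nat -> {linear ell2 R -> ell2 R})
    (RH : nat -> {linear ell2 R -> L2 R})
    (P_convergent : convergent_prediction P)
    (RH_inj : forall k, injective (RH k))
    (RH_P : forall k, RH k.+1 \o P k = RH k :> (ell2 R -> L2 R))
    (argmin_exists : forall k f, exists v, minimizer (discr_cost RH k f) v) :
  let D := discr_op RH in
  let Dec := decim_op P RH in
  [/\ (forall k f, exists! v, minimizer (discr_cost RH k f) v) /\
        (forall k w, exists! v, minimizer (decim_cost P RH k w) v),
      (forall k, discretization (D k)) /\
        (forall k, consistent (D k) (RH k)),
      (forall k, decimation D k (Dec k)) /\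
        (forall k, consistent (Dec k) (P k)),
      nested D &
      forall k, Dec k = D k \o RH k.+1 /\ P k = D k.+1 \o RH k :> (_ -> _)].
Proof.
move=> D Dec.
have RHP k v : RH k.+1 (P k v) = RH k v by rewrite -[RHS](congr1 (@^~ v) (RH_P k)).
have uniq_min k f u v : minimizer (discr_cost RH k f) u ->
    minimizer (discr_cost RH k f) v -> u = v.
  exact: minimizer_uniq.
have D_min k f : minimizer (discr_cost RH k f) (D k f) by exact: argmin_minimizer.
have ortho k f u : Ldot (f - RH k (D k f)) (RH k u) = 0.
  by have /minimizerP := D_min k f; apply.
have D_eq k f v : (forall u, Ldot (f - RH k v) (RH k u) = 0) -> D k f = v.
  by move=> /minimizerP vmin; exact: uniq_min (D_min k f) vmin.
have costE k w : decim_cost P RH k w = discr_cost RH k (RH k.+1 w).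
  by apply/funext => v; rewrite /decim_cost /hnorm linearB/= RHP.
have DecE k : Dec k = D k \o RH k.+1.
  by apply/funext => w; rewrite /Dec /decim_op costE.
have DK k : consistent (D k) (RH k).
  by apply/funext => v; apply: D_eq => u /=; rewrite subrr Ldot0l.
have DKv k v : D k (RH k v) = v := congr1 (@^~ v) (DK k).
have D_linear k : linear (D k).
  move=> a f g; apply: D_eq => u.
  have -> : a *: f + g - RH k (a *: D k f + D k g) =
      a *: (f - RH k (D k f)) + (g - RH k (D k g)).
    by rewrite linearP scalerBr opprD addrACA.
  by rewrite LdotDl LdotZl !ortho mulr0 addr0.
have Dec_dec k : decimation D k (Dec k).
  move=> f; rewrite DecE /=; apply: D_eq => u.
  (* Both residuals on the right are orthogonal to the range of R_k, the second because R_k u =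
     R_(k+1) (P_k u). *)
  have -> : RH k.+1 (D k.+1 f) - RH k (D k f) =
      (f - RH k (D k f)) - (f - RH k.+1 (D k.+1 f)).
    by rewrite opprB [RHS]addrC subrKA.
  by rewrite LdotBl ortho -(RHP k u) ortho subrr.
have D0 k : D k 0 = 0 by rewrite -(linear0 (RH k)) DKv.
split.
- split=> k f; last rewrite costE.
  + by exists (D k f); split=> // v; exact: uniq_min.
  + by exists (D k (RH k.+1 f)); split=> // v; exact: uniq_min.
- split=> k; last exact: DK.
  split; [exact: D_linear| |by eexists; exact: ell2_hilbert_basis].
  by apply/seteqP; split => // v _; exists (RH k v).
- split=> k; first exact: Dec_dec.
  by apply/funext => v /=; rewrite DecE /= RHP DKv.
(* D_k f is the image of D_(k+1) f = 0 under Dec_k, which sends 0 to 0. *)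
- by move=> f k Df0; rewrite -Dec_dec Df0 DecE /= linear0 D0.
- by move=> k; split; [exact: DecE|apply/funext => v /=; rewrite -RHP DKv].
Qed.
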